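(* Let $H$ be a separable infinite-dimensional complex Hilbert space and let $A$ be a self-adjoint unbounded linear operator in $H$ with $(Au,u)\ge (u,u)$ for all $u\in\mathrm{Dom}\,A$. Let $\varphi_0,\varphi_1:[1,\infty)\to(0,\infty)$ be Borel measurable functions with $\varphi_0/\varphi_1$ bounded on $[1,\infty)$, let $\psi\in\mathcal{B}$ be pseudoconcave in a neighbourhood of infinity, and put $$\varphi(t):=\varphi_0(t)\,\psi\Bigl(\frac{\varphi_1(t)}{\varphi_0(t)}\Bigr)\ (t\ge1),\qquad \varkappa:=\inf_{t\ge1}\frac{\varphi_1(t)}{\varphi_0(t)}>0 .$$ Let $c_{\psi,\varkappa}>0$ be a number such that $$\frac{\psi(t)}{\psi(\tau)}\le c_{\psi,\varkappa}\max\Bigl\{1,\frac{t}{\tau}\Bigr\}\quad\text{for all } t,\tau\in[\varkappa,\infty)$$ (such a number exists). Then for every $\tau\ge\varkappa$ and every $u\in H^{\varphi_1}_A$, $$\|u\|_{\varphi}\le c_{\psi,\varkappa}\,\psi(\tau)\bigl(\|u\|_{\varphi_0}^2+\tau^{-2}\|u\|_{\varphi_1}^2\bigr)^{1/2}.$$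
   Context: Spaces $H^\varphi_A$: here $\mathrm{Spec}\,A\subseteq[1,\infty)$. For a Borel measurable function $\varphi:[1,\infty)\to(0,\infty)$ the self-adjoint operator $\varphi(A)$ in $H$ is defined by the spectral decomposition of $A$, and $H^{\varphi}_{A}$ is the Hilbert space obtained by completing $\mathrm{Dom}\,\varphi(A)$ in the norm $\|u\|_{\varphi}:=\|\varphi(A)u\|_H$; the norm in the whole $H^\varphi_A$ is also denoted $\|\cdot\|_\varphi$. If $\varphi_0/\varphi_1$ is bounded on $[1,\infty)$, the identity mapping on $\mathrm{Dom}\,\varphi_1(A)$ extends uniquely to a continuous embedding $H^{\varphi_1}_A\hookrightarrow H^{\varphi_0}_A$, by which $H^{\varphi_1}_A$ is regarded as a linear manifold in $H^{\varphi_0}_A$. In the setting of the claim one has continuous embeddings $H^{\varphi_1}_A\hookrightarrow H^{\varphi}_A\hookrightarrow H^{\varphi_0}_A$. $\mathcal{B}$ is the set of all Borel measurable functions $\psi:(0,\infty)\to(0,\infty)$ such that $\psi$ is bounded on each $[a,b]$ with $0<a<b<\infty$ and $1/\psi$ is bounded on each $[r,\infty)$ with $r>0$. A function $\psi\in\mathcal{B}$ is pseudoconcave in a neighbourhood of infinity if there exist $r>0$ and a concave function $\psi_1:(r,\infty)\to(0,\infty)$ such that $\psi/\psi_1$ and $\psi_1/\psi$ are bounded on $(r,\infty)$. *)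

(* Defs.v *)
From HB Require Import structures.
From mathcomp Require Import all_boot all_order all_algebra complex.
From mathcomp Require Import all_classical all_reals all_analysis.

Set Implicit Arguments.
Unset Strict Implicit.
Unset Printing Implicit Defensive.

Import Order.TTheory GRing.Theory Num.Theory.
Import numFieldNormedType.Exports.
Import HBSimple.

Local Open Scope classical_set_scope.
Local Open Scope ring_scope.
Local Open Scope complex_scope.

(* As for every {dot _ for _}, the inner product is linear in its first
   argument and conjugate-linear in the second one. *)
Structure hilbertSpace (R : realType) := HilbertSpace {
  hilbert_sort :> completeNormedModType R[i];
  inner : {dot hilbert_sort for @Num.conj R[i]};
  normE_inner : forall u : hilbert_sort, `|u| ^+ 2 = inner u u
}.

(* The norm of a normed module over R[i] is R[i]-valued. *)
Definition rnorm (R : realType) (V : normedModType R[i]) (u : V) : R :=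
  complex.Re `|u|.

Definition separable (T : topologicalType) :=
  exists S : set T, countable S /\ dense S.

Definition infinite_dimensional (K : pzRingType) (V : lmodType K) :=
  forall (n : nat) (e : 'I_n -> V),
    exists u : V, forall a : 'I_n -> K, u <> \sum_i a i *: e i.

Section operators.
Context (R : realType) (H : hilbertSpace R).

(* The values of [op_fun] outside [op_dom] are irrelevant. *)
Structure linearOperator := LinearOperator {
  op_dom : set H;
  op_fun :> H -> H;
  op_dom0 : op_dom 0;
  op_domP : forall (a : R[i]) u v,
    op_dom u -> op_dom v -> op_dom (a *: u + v);
  op_linear : forall (a : R[i]) u v,
    op_dom u -> op_dom v -> op_fun (a *: u + v) = a *: op_fun u + op_fun v
}.

Implicit Types A : linearOperator.

Definition unbounded_operator A :=
  ~ exists M : R, forall u, op_dom A u -> rnorm (A u) <= M * rnorm u.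

Definition adjoint_graph A : set (H * H) :=
  [set p | forall u, op_dom A u -> inner H (A u) p.1 = inner H u p.2].

Definition self_adjoint A :=
  dense (op_dom A) /\
  [set p | op_dom A p.1 /\ A p.1 = p.2] = adjoint_graph A.

End operators.

Section spectral_calculus.
Context (R : realType) (H : hilbertSpace R).

(* Projection-valued measures on the Borel sets of R; the values of [spm] on
   other sets are irrelevant. *)
Structure spectralMeasure := SpectralMeasure {
  spm :> set R -> H -> H;
  spm_linear : forall B, measurable B -> linear (spm B);
  spm_symmetric : forall B, measurable B ->
    forall u v, inner H (spm B u) v = inner H u (spm B v);
  spm_setI : forall B C, measurable B -> measurable C ->
    forall u, spm (B `&` C) u = spm B (spm C u);
  spm_setT : forall u, spm setT u = u;
  spm_sigma_additive : forall F : (set R)^nat,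
    (forall n, measurable (F n)) -> trivIset setT F ->
    forall u, (fun n => \sum_(0 <= k < n) spm (F k) u) @ \oo
      --> spm (\bigcup_n F n) u
}.

Variable E : spectralMeasure.

(* (E(B)u, u) = |E(B)u|^2 for every Borel set B. *)
Definition scalar_spm (u : H) (B : set R) : \bar R :=
  (rnorm (E B u) ^+ 2)%:E.

Definition spectral_sum (s : R -> R) (u : H) : H :=
  \sum_(c \in range s) c%:C *: E (s @^-1` [set c]) u.

(* The operator f(A) = \int f dE, for A = \int t dE(t): since
   |s(A)u|^2 = \int s^2 d(Eu,u) for simple functions s, the vector f(A)u is
   the limit of s_n(A)u for any simple functions s_n tending to f in
   L^2((Eu,u)). *)
Definition fcalc_dom (f : R -> R) : set H :=
  [set u | (\int[scalar_spm u]_t (f t ^+ 2)%:E < +oo)%E].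

Definition fcalc (f : R -> R) (u : H) : H :=
  xget 0 [set w | exists s : {sfun R >-> R}^nat,
    (fun n => \int[scalar_spm u]_t ((s n t - f t) ^+ 2)%:E)%E @ \oo --> 0%E /\
    (fun n => spectral_sum (s n) u) @ \oo --> w].

Definition spectral_decomposition (A : linearOperator H) :=
  op_dom A = fcalc_dom id /\ forall u, op_dom A u -> A u = fcalc id u.

(* A function on [1, +oo[ is encoded as a function on R whose values outside
   [1, +oo[ are discarded; this is harmless since the spectral measure of an
   operator A with (Au, u) >= (u, u) is concentrated on [1, +oo[. *)
Definition op_phi_dom (phi : R -> R) : set H :=
  fcalc_dom (phi \_ `[1, +oo[).

Definition op_phi (phi : R -> R) : H -> H := fcalc (phi \_ `[1, +oo[).

(* The completion of Dom phi(A) in the norm |phi(A)u|; it is unique up to a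
   unique isometric isomorphism that respects [phi_incl]. *)
Structure phiSpace (phi : R -> R) := PhiSpace {
  phi_sort :> hilbertSpace R;
  phi_incl : H -> phi_sort;
  phi_incl_linear : forall (a : R[i]) u v,
    op_phi_dom phi u -> op_phi_dom phi v ->
    phi_incl (a *: u + v) = a *: phi_incl u + phi_incl v;
  rnorm_phi_incl : forall u,
    op_phi_dom phi u -> rnorm (phi_incl u) = rnorm (op_phi phi u);
  phi_incl_dense : dense (phi_incl @` op_phi_dom phi)
}.

(* The unique continuous linear extension of the identity map on
   Dom phi1(A), where Dom phi1(A) is contained in Dom phi0(A). *)
Definition phi_embedding (phi1 phi0 : R -> R)
    (X1 : phiSpace phi1) (X0 : phiSpace phi0) : X1 -> X0 :=
  xget (fun=> 0) [set iota : X1 -> X0 |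
    [/\ linear iota, continuous iota &
        forall u, op_phi_dom phi1 u -> iota (phi_incl X1 u) = phi_incl X0 u]].

End spectral_calculus.

Arguments phi_embedding {R H E phi1 phi0} X1 X0 _.

Section interpolation_parameter.
Context (R : realType).
Implicit Types psi phi : R -> R.

Definition class_B psi :=
  [/\ measurable_fun (`]0, +oo[ : set R) psi,
      forall t, 0 < t -> 0 < psi t,
      forall a b, 0 < a -> a < b -> [bounded psi t | t in `[a, b]] &
      forall r, 0 < r -> [bounded (psi t)^-1 | t in `[r, +oo[]].

Definition concave_on (D : set R) psi :=
  convex_function (D : set R^o) (fun t => - psi t).

Definition pseudoconcave_near_infty psi :=
  exists r psi1,
    [/\ 0 < r,
        forall t, r < t -> 0 < psi1 t,
        concave_on `]r, +oo[ psi1,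
        [bounded psi t / psi1 t | t in `]r, +oo[] &
        [bounded psi1 t / psi t | t in `]r, +oo[]].

Definition weight phi :=
  measurable_fun (`[1, +oo[ : set R) phi /\ forall t, 1 <= t -> 0 < phi t.

Definition weight_comp psi phi0 phi1 : R -> R :=
  fun t => phi0 t * psi (phi1 t / phi0 t).

Definition kappa phi0 phi1 : R :=
  inf [set phi1 t / phi0 t | t in `[1, +oo[].

Definition ratio_bound psi (k c : R) :=
  forall t tau, k <= t -> k <= tau ->
    psi t / psi tau <= c * Num.max 1 (t / tau).

End interpolation_parameter.

(* Main.v *)
(* Since d(E u, u) is a measure with |f(A) u|^2 = \int f^2 d(E u, u), a pointwise
   inequality f^2 <= a g^2 + b h^2 between weights yields the inequality
   |f(A) u|^2 <= a |g(A) u|^2 + b |h(A) u|^2, which extends from Dom phi1(A) to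
   its completion by density.  It is applied to the weight phi: at
   x = phi1(t) / phi0(t) the hypothesis on c gives
   psi(x)^2 <= c^2 psi(tau)^2 max(1, x / tau)^2, and max(1, y)^2 <= 1 + y^2.

   The number c exists because a positive concave function g on ]r, +oo[ is
   nondecreasing and satisfies g(t) <= 2 (t / tau) g(tau) for t >= tau > 2 r:
   compare the chord from tau / 2 to t with the value at tau. *)

Require Import Defs.
From HB Require Import structures.
From mathcomp Require Import all_boot all_order all_algebra complex.
From mathcomp Require Import all_classical all_reals all_analysis.
From mathcomp Require Import measurable_realfun.
From mathcomp Require Import ring lra.

Set Implicit Arguments.
Unset Strict Implicit.
Unset Printing Implicit Defensive.

Import Order.TTheory GRing.Theory Num.Theory.
Import numFieldNormedType.Exports.

Local Open Scope classical_set_scope.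
Local Open Scope ring_scope.
Local Open Scope complex_scope.

(** * The real-valued norm and the inner product *)

Section real_valued_norm.
Context {R : realType} {V : normedModType R[i]}.
Implicit Types u v : V.

Lemma rnormE u : (rnorm u)%:C = `|u|.
Proof. by rewrite /rnorm RRe_real ?ger0_real ?normr_ge0. Qed.

Lemma rnorm_ge0 u : 0 <= rnorm u.
Proof. by rewrite -lecR rnormE; exact: normr_ge0. Qed.

Lemma ler_rnormD u v : rnorm (u + v) <= rnorm u + rnorm v.
Proof. by rewrite -lecR rmorphD/= !rnormE ler_normD. Qed.

Lemma rnormZ (a : R[i]) u : rnorm (a *: u) = complex.Re `|a| * rnorm u.
Proof.
have aE : (complex.Re `|a|)%:C = `|a| by rewrite RRe_real ?ger0_real ?normr_ge0.
by apply: complexI; rewrite rmorphM/= aE !rnormE normrZ.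
Qed.

Lemma rnorm0 : rnorm (0 : V) = 0.
Proof. by rewrite /rnorm normr0. Qed.

Lemma rnorm_eq0 u : (rnorm u == 0) = (u == 0).
Proof.
apply/eqP/eqP => [u0|->]; last exact: rnorm0.
by apply/eqP; rewrite -normr_eq0 -rnormE u0.
Qed.

Lemma rnormB u v : rnorm (u - v) = rnorm (v - u).
Proof. by rewrite /rnorm distrC. Qed.

Lemma ler_rnorm_dist u v : `|rnorm u - rnorm v| <= rnorm (u - v).
Proof.
have le u1 v1 : rnorm u1 - rnorm v1 <= rnorm (u1 - v1).
  by rewrite lerBlDr; apply: le_trans (ler_rnormD _ _); rewrite subrK.
by rewrite ler_norml le andbT lerNl opprB rnormB le.
Qed.

Lemma rnorm_cvgP {T : Type} (F : set_system T) {FF : Filter F} (f : T -> V) v :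
  f @ F --> v <-> forall e : R, 0 < e -> \forall x \near F, rnorm (v - f x) < e.
Proof.
split=> [/cvgrPdist_lt fv e e0|fv].
  have /fv : 0 < e%:C by rewrite ltcR.
  by apply: filterS => x; rewrite -rnormE ltcR.
apply/cvgrPdist_lt => e e0.
have eE : (complex.Re e)%:C = e by rewrite RRe_real ?gtr0_real.
have /fv : 0 < complex.Re e by rewrite -ltcR eE.
by apply: filterS => x; rewrite -ltcR rnormE eE.
Qed.

Lemma nbhs_rnorm_ball u (e : R) : 0 < e -> \forall v \near u, rnorm (u - v) < e.
Proof. by apply: (rnorm_cvgP id u).1; exact: cvg_id. Qed.

Lemma continuous_rnorm : continuous (@rnorm R V).
Proof.
move=> u; apply/cvgrPdist_lt => e /(nbhs_rnorm_ball u).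
by apply: filterS => v; apply: le_lt_trans; exact: ler_rnorm_dist.
Qed.

Lemma cvg_rnorm {T : Type} (F : set_system T) {FF : Filter F} (f : T -> V) v :
  f @ F --> v -> rnorm (f x) @[x --> F] --> rnorm v.
Proof. by move=> fv; apply: (cvg_comp f _ fv); exact: continuous_rnorm. Qed.

Lemma cvg_rnorm_sqr {T : Type} (F : set_system T) {FF : Filter F} (f : T -> V) v :
  f @ F --> v -> rnorm (f x) ^+ 2 @[x --> F] --> rnorm v ^+ 2.
Proof.
move=> /cvg_rnorm fv; rewrite expr2; under eq_fun do rewrite expr2.
exact: cvgM.
Qed.

End real_valued_norm.

Lemma rnorm_cauchy_cvg {R : realType} {V : completeNormedModType R[i]}
    (u : nat -> V) :
  (forall e : R, 0 < e -> exists N : nat, forall n, (N <= n)%N ->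
     rnorm (u N - u n) < e) ->
  exists v : V, u @ \oo --> v.
Proof.
move=> uC; apply/cvg_ex/cauchy_cvgP/cauchyP => e e0.
have eE : (complex.Re e)%:C = e by rewrite RRe_real ?gtr0_real.
have /uC[N uN] : 0 < complex.Re e by rewrite -ltcR eE.
exists (u N), N => // n /= Nn.
by rewrite -ball_normE/= -rnormE -eE ltcR; exact: uN.
Qed.

Section inner_product.
Context {R : realType} {H : hilbertSpace R}.
Implicit Types u v : H.

Lemma rnorm_sqrE u : (rnorm u ^+ 2)%:C = inner H u u.
Proof. by rewrite -normE_inner rmorphXn/= rnormE. Qed.

Lemma inner_sym0 u v : inner H u v = 0 -> inner H v u = 0.
Proof.
move=> uv; transitivity ((inner H u v)^* )%R; last by rewrite uv conjC0.
by rewrite [LHS]hermC expr0 mul1r.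
Qed.

Lemma rnorm_sqrD_orthogonal u v : inner H u v = 0 ->
  rnorm (u + v) ^+ 2 = rnorm u ^+ 2 + rnorm v ^+ 2.
Proof.
move=> uv; apply: complexI; rewrite rmorphD/= !rnorm_sqrE.
by rewrite linearDl/= !linearDr/= uv (inner_sym0 uv) addr0 add0r.
Qed.

Lemma rnorm_parallelogram u v :
  rnorm (u + v) ^+ 2 + rnorm (u - v) ^+ 2 =
  rnorm u ^+ 2 + rnorm v ^+ 2 + (rnorm u ^+ 2 + rnorm v ^+ 2).
Proof.
apply: complexI; rewrite !rmorphD/= !rnorm_sqrE.
rewrite !linearDl/= !linearDr/= !linearNl/= !linearNr/=.
by ring.
Qed.

Lemma rnorm_sqr_sum_orthogonal {I : eqType} (r : seq I) (x : I -> H) :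
  uniq r -> (forall i j, i \in r -> j \in r -> i != j ->
    inner H (x i) (x j) = 0) ->
  rnorm (\sum_(i <- r) x i) ^+ 2 = \sum_(i <- r) rnorm (x i) ^+ 2.
Proof.
elim: r => [_ _|i r IHr /= /andP[ir ur] x_orth].
  by rewrite !big_nil rnorm0 expr0n.
rewrite !big_cons rnorm_sqrD_orthogonal ?IHr//.
  by move=> j k jr kr; apply: x_orth; rewrite in_cons ?jr ?kr orbT.
rewrite linear_sumr big_seq big1// => j jr.
apply: x_orth; rewrite ?mem_head// ?in_cons ?jr ?orbT//.
by apply: contraNneq ir => ->.
Qed.

End inner_product.

(** * Spectral measures *)

Section scalar_spectral_measure.
Context {R : realType} {H : hilbertSpace R} (E : spectralMeasure H).
Implicit Types (B C : set R) (u v : H).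

Lemma spmD B u v : measurable B -> E B (u + v) = E B u + E B v.
Proof. by move=> /(spm_linear E)/(_ 1 u v); rewrite !scale1r. Qed.

Lemma spmr0 B : measurable B -> E B 0 = 0.
Proof.
move=> mB; have := spmD 0 0 mB; rewrite addr0.
by move=> /(congr1 (fun w => w - E B 0)); rewrite subrr addrK.
Qed.

Lemma spmZ B (a : R[i]) u : measurable B -> E B (a *: u) = a *: E B u.
Proof.
by move=> mB; have := spm_linear E mB a u 0; rewrite spmr0// !addr0.
Qed.

(** For the constant family of empty sets, sigma-additivity makes a series with all terms equal to
    [E set0 u] converge, so its terms tend to 0. *)
Lemma spm_set0 u : E set0 u = 0.
Proof.
have triv0 : trivIset setT (fun _ : nat => set0 : set R) by apply: trivIset_set0.
have /cvgP/cvg_series_cvg_0 u0 := @spm_sigma_additive _ _ E _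
  (fun=> measurable0) triv0 u.
by apply: (cvg_unique _ _ u0); [exact: norm_hausdorff|exact: cvg_cst].
Qed.

(** Moving the symmetric [E B] to the right factor leaves the projection of the intersection of [B]
    and [C], which is zero. *)
Lemma spm_orthogonal B C u v : measurable B -> measurable C ->
  B `&` C = set0 -> inner H (E B u) (E C v) = 0.
Proof.
move=> mB mC BC; rewrite spm_symmetric// -spm_setI// BC spm_set0.
exact: linear0r.
Qed.

Lemma spm_setU B C u : measurable B -> measurable C -> B `&` C = set0 ->
  E (B `|` C) u = E B u + E C u.
Proof.
move=> mB mC BC.
have mF n : measurable (bigcup2 B C n) by case: n => [|[|n]] /=.
have := BC; rewrite trivIset_bigcup2 => tBC.
have := @spm_sigma_additive _ _ E _ mF tBC u; rewrite bigcup2E => EBC.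
apply: (cvg_unique _ EBC); first exact: norm_hausdorff.
(* From two terms on the partial sums are constant, since all later sets of the sequence are
   empty. *)
apply: cvg_near_cst; exists 2%N => // -[|[|n]]//= _.
rewrite big_ltn// big_ltn//= big_nat_cond big1 ?addr0// => -[|[|i]]//= _.
exact: spm_set0.
Qed.

Lemma spm_bigsetU {I : eqType} (r : seq I) (F : I -> set R) u :
  uniq r -> (forall i, measurable (F i)) ->
  (forall i j, i != j -> F i `&` F j = set0) ->
  E (\big[setU/set0]_(i <- r) F i) u = \sum_(i <- r) E (F i) u.
Proof.
move=> + mF F0; elim: r => [_|i r IHr /= /andP[ir ur]].
  by rewrite !big_nil spm_set0.
rewrite !big_cons spm_setU ?IHr//; first exact: bigsetU_measurable.
rewrite setIC big_distrl/= big_seq big1// => j jr.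
by apply: F0; apply: contraNneq ir => <-.
Qed.

Let scalar_spm0 u : scalar_spm E u set0 = 0%E.
Proof. by rewrite /scalar_spm spm_set0 rnorm0 expr0n. Qed.

Let scalar_spm_ge0 u B : (0 <= scalar_spm E u B)%E.
Proof. by rewrite lee_fin sqr_ge0. Qed.

(** By orthogonality the partial sums of the squared norms are the squared norms of the partial
    sums, and these converge because the vector series does. *)
Let scalar_spm_sigma_additive u : semi_sigma_additive (scalar_spm E u).
Proof.
move=> F mF tF mUF.
have -> : (fun n => \sum_(0 <= i < n) scalar_spm E u (F i))%E =
    (fun n => (rnorm (\sum_(0 <= i < n) E (F i) u) ^+ 2)%:E).
  apply/funext => n; rewrite sumEFin rnorm_sqr_sum_orthogonal// ?iota_uniq//.
  move=> i j _ _ ij; apply: spm_orthogonal => //.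
  by apply/eqP; move: ij; apply: contraNT => /set0P/tF ->.
apply: cvg_EFin; first exact: nearW.
by apply: cvg_rnorm_sqr; exact: spm_sigma_additive.
Qed.

HB.instance Definition _ u := isMeasure.Build _ _ _ (scalar_spm E u)
  (scalar_spm0 u) (@scalar_spm_ge0 u) (@scalar_spm_sigma_additive u).

End scalar_spectral_measure.

(** * Spectral sums of simple functions and their isometry *)

Section simple_functions.
Context {R : realType} {H : hilbertSpace R} (E : spectralMeasure H).
Import HBSimple.
Implicit Types (s t : {sfun R >-> R}) (u : H).

Let values s : seq R := finmap.enum_fset (fset_set (range s)).

Let mem_values s x : s x \in values s.
Proof. by rewrite in_fset_set; [exact/mem_set/imageT|exact: fimfunP]. Qed.

Let uniq_values s : uniq (values s).
Proof. exact: finmap.fset_uniq. Qed.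

Let measurable_level s (c : R) : measurable (s @^-1` [set c]).
Proof. exact: measurable_sfunP. Qed.

(** The cells of the common refinement of the level partitions of [s] and [t]; some cells may be
    empty. *)
Let level s t (p : R * R) : set R := s @^-1` [set p.1] `&` t @^-1` [set p.2].

Let measurable_level2 s t p : measurable (level s t p).
Proof. by apply: measurableI. Qed.

Let level_disjoint s t p q : p != q -> level s t p `&` level s t q = set0.
Proof.
move=> pq; rewrite -subset0 => x [[/= sp tp] [/= sq tq]].
by move/eqP: pq; apply;
  rewrite (surjective_pairing p) -sp -tp sq tq -surjective_pairing.
Qed.

Let bigsetU_level s t c :
  \big[setU/set0]_(d <- values t) level s t (c, d) = s @^-1` [set c].
Proof.
apply/seteqP; split=> x; rewrite -bigcup_seq /=.
  by case=> d _ [].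
by move=> sx; exists (t x) => //=; exact: mem_values.
Qed.

Let spectral_sum_refine s t u : spectral_sum E s u =
  \sum_(c <- values s) \sum_(d <- values t) c%:C *: E (level s t (c, d)) u.
Proof.
rewrite /spectral_sum fsbig_finite; last exact: fimfunP.
apply: eq_bigr => c _; rewrite -scaler_sumr; congr (_ *: _).
rewrite -spm_bigsetU ?bigsetU_level ?uniq_values// => d d' dd'.
by apply: level_disjoint; apply: contraNneq dd' => -[->].
Qed.

Let pairs s t := [seq (c, d) | c <- values s, d <- values t].

Let spectral_sumB s t u : spectral_sum E s u - spectral_sum E t u =
  \sum_(p <- pairs s t) (p.1 - p.2)%:C *: E (level s t p) u.
Proof.
rewrite (spectral_sum_refine s t) (spectral_sum_refine t s) [X in _ - X]exchange_big.
rewrite big_allpairs -sumrB; apply: eq_bigr => c _.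
rewrite -sumrB; apply: eq_bigr => d _.
by rewrite rmorphB/= scalerBl /level/= [in X in _ - X]setIC.
Qed.

Let sqrB_indic s t x : (s x - t x) ^+ 2 =
  \sum_(p <- pairs s t) (p.1 - p.2) ^+ 2 * \1_(level s t p) x.
Proof.
have upairs : uniq (pairs s t).
  by apply: allpairs_uniq; rewrite ?uniq_values// => -[? ?] [? ?].
(* The point [x] lies in exactly one cell, the one of index [(s x, t x)]. *)
rewrite (bigD1_seq (s x, t x))//=; last first.
  by apply: allpairs_f; exact: mem_values.
rewrite indicE mem_set//= mulr1 big1 ?addr0// => p pE.
rewrite indicE memNset ?mulr0// => -[/= sp tp].
by move/eqP: pE; apply; rewrite (surjective_pairing p) sp tp.
Qed.

(** On the common refinement the difference is an orthogonal sum with coefficients [p.1 - p.2], so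
    Pythagoras yields the integral of a simple function. This isometry carries the L^2 Cauchy
    property over to [H]. *)
Lemma rnorm_sqr_spectral_sumB s t u :
  ((rnorm (spectral_sum E s u - spectral_sum E t u) ^+ 2)%:E =
   \int[scalar_spm E u]_x ((s x - t x) ^+ 2)%:E)%E.
Proof.
rewrite spectral_sumB rnorm_sqr_sum_orthogonal; first last.
- move=> p q _ _ pq; rewrite linearZl_LR linearZr_LR/=.
  by rewrite spm_orthogonal ?mulr0//; exact: level_disjoint.
- by apply: allpairs_uniq; rewrite ?uniq_values// => -[? ?] [? ?].
under eq_integral do rewrite sqrB_indic -sumEFin.
rewrite ge0_integral_sum//; first last.
- by move=> p x _; rewrite lee_fin mulr_ge0// sqr_ge0.
- move=> p; apply/measurable_EFinP; apply: measurable_funM.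
    exact: measurable_cst.
  exact: measurable_indic.
rewrite -sumEFin; apply: eq_bigr => p _.
under eq_integral do rewrite EFinM.
rewrite ge0_integralZl_EFin ?sqr_ge0//; first last.
- by apply/measurable_EFinP; exact: measurable_indic.
rewrite integral_indic// setIT rnormZ exprMn EFinM /scalar_spm.
congr (_ * _)%E; congr EFin.
by rewrite normc_def/= expr0n/= addr0 sqr_sqrtr ?sqr_ge0.
Qed.

End simple_functions.

(** * Square integrals *)

Section square_integrals.
Context d (T : measurableType d) (R : realType).
Variable mu : {measure set T -> \bar R}.
Implicit Types f g h : T -> R.

Lemma measurable_sqr_EFin f : measurable_fun setT f ->
  measurable_fun setT (fun x => (f x ^+ 2)%:E).
Proof. by move=> mf; apply/measurable_EFinP; exact: measurable_funX. Qed.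

Lemma integral_sqr_ge0 f : (0 <= \int[mu]_x (f x ^+ 2)%:E)%E.
Proof. by apply: integral_ge0 => x _; rewrite lee_fin sqr_ge0. Qed.

(** All integrands are non-negative, so monotonicity and linearity hold even when some integrals are
    infinite. *)
Lemma integral_sqr_le2 (a b : R) f g h : 0 <= a -> 0 <= b ->
  measurable_fun setT f -> measurable_fun setT g -> measurable_fun setT h ->
  (forall x, f x ^+ 2 <= a * g x ^+ 2 + b * h x ^+ 2) ->
  (\int[mu]_x (f x ^+ 2)%:E <=
   a%:E * \int[mu]_x (g x ^+ 2)%:E + b%:E * \int[mu]_x (h x ^+ 2)%:E)%E.
Proof.
move=> a0 b0 mf mg mh fgh.
have sqr_ge0E (k : T -> R) x : setT x -> (0 <= (k x ^+ 2)%:E)%E.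
  by rewrite lee_fin sqr_ge0.
have mZ (c : R) (k : T -> R) : measurable_fun setT k ->
    measurable_fun setT (fun x => c%:E * (k x ^+ 2)%:E)%E.
  by move=> mk; apply: emeasurable_funM;
    [exact: measurable_cst|exact: measurable_sqr_EFin].
rewrite -ge0_integralZl_EFin//; [|exact: sqr_ge0E|exact: measurable_sqr_EFin].
rewrite -ge0_integralZl_EFin//; [|exact: sqr_ge0E|exact: measurable_sqr_EFin].
rewrite -ge0_integralD//; first last.
- exact: mZ.
- by move=> x _; rewrite mule_ge0// lee_fin// sqr_ge0.
- exact: mZ.
- by move=> x _; rewrite mule_ge0// lee_fin// sqr_ge0.
apply: ge0_le_integral => //; [exact: sqr_ge0E|exact: measurable_sqr_EFin| |].
  by apply: emeasurable_funD; exact: mZ.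
by move=> x _; rewrite -!EFinM -EFinD lee_fin.
Qed.

(* Young's inequality [2 g (f - g) <= e g^2 + (f - g)^2 / e], integrated; it
   stands in for Minkowski's inequality. *)
Lemma integral_sqr_le_perturb (e : R) f g : 0 < e ->
  measurable_fun setT f -> measurable_fun setT g ->
  (\int[mu]_x (f x ^+ 2)%:E <=
   (1 + e)%:E * \int[mu]_x (g x ^+ 2)%:E +
   (1 + e^-1)%:E * \int[mu]_x ((f x - g x) ^+ 2)%:E)%E.
Proof.
move=> e0 mf mg; apply: integral_sqr_le2 => //.
- by rewrite addr_ge0// ltW.
- by rewrite addr_ge0// invr_ge0 ltW.
- exact: measurable_funB.
move=> x; rewrite -subr_ge0.
rewrite (_ : _ - _ = e^-1 * (e * g x - (f x - g x)) ^+ 2).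
  by rewrite mulr_ge0 ?sqr_ge0// invr_ge0 ltW.
by field; exact: lt0r_neq0.
Qed.

Lemma integral_sqrB_sym f g :
  (\int[mu]_x ((f x - g x) ^+ 2)%:E = \int[mu]_x ((g x - f x) ^+ 2)%:E)%E.
Proof. by apply: eq_integral => x _; rewrite -sqrrN opprB. Qed.

Import HBSimple HBNNSimple.

(** The standard approximations increase with [n], so each stays below the limit; this bound
    provides the majorant in [sfun_dense_L2]. *)
Lemma nnsfun_cvg_below f : measurable_fun setT f -> (forall x, 0 <= f x) ->
  exists p : {nnsfun T >-> R}^nat,
    (forall n x, p n x <= f x) /\ (forall x, p n x @[n --> \oo] --> f x).
Proof.
move=> mf f0; have mEf : measurable_fun setT (EFin \o f) by exact/measurable_EFinP.
exists (nnsfun_approx measurableT mEf).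
have pf x : nnsfun_approx measurableT mEf n x @[n --> \oo] --> f x.
  have : (EFin \o (fun n => nnsfun_approx measurableT mEf n x)) @ \oo -->
      (f x)%:E.
    by apply: cvg_nnsfun_approx => // y _; rewrite lee_fin.
  by move=> /fine_cvgP[].
split=> // n x; rewrite -(cvg_lim _ (pf x))//.
apply: (nondecreasing_cvgn_le (u_ := fun k => nnsfun_approx measurableT mEf k x)).
  by move=> k m km; have /lefP := nd_nnsfun_approx measurableT mEf km; apply.
by apply/cvg_ex; exists (f x).
Qed.

(** The positive and negative parts are approximated from below. The difference [s n] then lies
    between 0 and [f], so that [f ^ 2] is an integrable majorant of the squared error and dominated
    convergence applies. *)
Lemma sfun_dense_L2 f : measurable_fun setT f ->
  (\int[mu]_x (f x ^+ 2)%:E < +oo)%E ->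
  exists s : {sfun T >-> R}^nat,
    (fun n => \int[mu]_x ((s n x - f x) ^+ 2)%:E)%E @ \oo --> 0%E.
Proof.
move=> mf f_fin.
have [|x|p [p_le p_cvg]] := @nnsfun_cvg_below (fun x => Num.max (f x) 0).
- by apply: measurable_maxr => //; exact: measurable_cst.
- by rewrite le_max lexx orbT.
have [|x|q [q_le q_cvg]] := @nnsfun_cvg_below (fun x => Num.max (- f x) 0).
- by apply: measurable_maxr; [exact: measurableT_comp|exact: measurable_cst].
- by rewrite le_max lexx orbT.
pose s n : {sfun T >-> R} := p n \- q n; exists s.
have s_cvg x : s n x @[n --> \oo] --> f x.
  rewrite [X in _ --> X](_ : _ = Num.max (f x) 0 - Num.max (- f x) 0).
    exact: (cvgB (p_cvg x) (q_cvg x)).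
  by case: (lerP 0 (f x)) => ?; case: (lerP 0 (- f x)) => ?; lra.
have s_le n x : (s n x - f x) ^+ 2 <= f x ^+ 2.
  have p0 : 0 <= p n x by [].
  have q0 : 0 <= q n x by [].
  have := p_le n x; have := q_le n x; rewrite /s/=.
  by case: (lerP 0 (f x)) => ?; case: (lerP 0 (- f x)) => ? ? ?; nra.
have ms n : measurable_fun setT (fun x => s n x - f x).
  by apply: measurable_funB.
have [|||||_ _] := @dominated_convergence _ _ _ mu setT measurableT
  (fun n x => ((s n x - f x) ^+ 2)%:E) (cst 0%E) (fun x => (f x ^+ 2)%:E).
- by move=> n; exact: measurable_sqr_EFin.
- exact: measurable_cst.
- apply: aeW => x _; apply: cvg_EFin; first exact: nearW.
  have sf : s n x - f x @[n --> \oo] --> 0.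
    by rewrite -(subrr (f x)); exact: (cvgB (s_cvg x) (cvg_cst _)).
  by have := cvgM sf sf; rewrite mulr0; apply.
- apply/integrableP; split; first exact: measurable_sqr_EFin.
  by under eq_integral do rewrite gee0_abs ?lee_fin ?sqr_ge0//.
- by apply: aeW => x n _; rewrite gee0_abs lee_fin// sqr_ge0.
by rewrite integral0.
Qed.

End square_integrals.

(** * The functional calculus *)

Section functional_calculus.
Context {R : realType} {H : hilbertSpace R} (E : spectralMeasure H).
Import HBSimple.
Implicit Types (f g : R -> R) (s : {sfun R >-> R}) (u v : H).

Lemma rnorm_sqr_spectral_sum s u :
  ((rnorm (spectral_sum E s u) ^+ 2)%:E =
   \int[scalar_spm E u]_x (s x ^+ 2)%:E)%E.
Proof.
(* The zero function has spectral sum 0, so this is the isometry for differences with second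
   function 0. *)
have -> : spectral_sum E s u =
    spectral_sum E s u - spectral_sum E (cst_sfun 0 : {sfun R >-> R}) u.
  rewrite [X in _ - X]fsbig1 ?subr0// => _ [x _ <-].
  by rewrite scale0r.
by rewrite rnorm_sqr_spectral_sumB; apply: eq_integral => x _; rewrite subr0.
Qed.

(** By the isometry, simple functions converging to [f] in L^2 have Cauchy spectral sums.
    Completeness gives a limit, so the [xget] in [fcalc] selects a genuine limit and not its default
    0. *)
Lemma fcalc_spec f u : measurable_fun setT f -> fcalc_dom E f u ->
  exists s : {sfun R >-> R}^nat,
    (fun n => \int[scalar_spm E u]_t ((s n t - f t) ^+ 2)%:E)%E @ \oo --> 0%E /\
    (fun n => spectral_sum E (s n) u) @ \oo --> fcalc E f u.
Proof.
move=> mf fu.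
pose is_fcalc := [set w : H | exists s : {sfun R >-> R}^nat,
  (fun n => \int[scalar_spm E u]_t ((s n t - f t) ^+ 2)%:E)%E @ \oo --> 0%E /\
  (fun n => spectral_sum E (s n) u) @ \oo --> w].
apply: (@xgetPex _ 0 is_fcalc).
have [s sf] := sfun_dense_L2 mf fu.
suff [w sw] : exists w : H, (fun n => spectral_sum E (s n) u) @ \oo --> w.
  by exists w, s.
apply: rnorm_cauchy_cvg => e e0.
(* The squared distance of two approximants is at most twice the sum of their squared errors, so
   errors up to [e ^+ 2 / 8] give at most [e ^+ 2 / 2]. *)
have e8 : 0 < e ^+ 2 / 8 by rewrite divr_gt0// exprn_gt0.
have [[N1 _ sfin] /cvgrPdist_lt/(_ _ e8)[N2 _ slt]] := (fine_cvgP _ _).1 sf.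
pose I n := (\int[scalar_spm E u]_t ((s n t - f t) ^+ 2)%:E)%E.
have Ilt n : (maxn N1 N2 <= n)%N -> (I n <= (e ^+ 2 / 8)%:E)%E.
  rewrite geq_max => /andP[/sfin In /slt]; rewrite sub0r normrN => ltI.
  rewrite /I -(fineK In) lee_fin; apply: ltW; apply: le_lt_trans ltI.
  exact: ler_norm.
exists (maxn N1 N2) => n Nn; set N := maxn N1 N2 in Ilt Nn *.
rewrite -ltr_sqr ?nnegrE ?rnorm_ge0 ?(ltW e0)// -lte_fin.
rewrite rnorm_sqr_spectral_sumB.
have /le_lt_trans : (\int[scalar_spm E u]_x ((s N x - s n x) ^+ 2)%:E <=
    2%:E * I N + 2%:E * I n)%E.
  apply: integral_sqr_le2 => //; try exact: measurable_funB.
  move=> x; rewrite -subr_ge0.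
  by rewrite (_ : _ - _ = (s N x + s n x - 2 * f x) ^+ 2) ?sqr_ge0//; ring.
apply; apply: (@le_lt_trans _ _
  (2%:E * (e ^+ 2 / 8)%:E + 2%:E * (e ^+ 2 / 8)%:E)%E).
  by apply: leeD; apply: lee_wpmul2l; rewrite ?lee_fin//; apply: Ilt => /=.
rewrite -!EFinM -EFinD lte_fin.
have e2 : 0 < e ^+ 2 by rewrite exprn_gt0.
by lra.
Qed.

(** The identity holds for the simple functions [s n]. The perturbation inequality is used in both
    directions between [f] and [s n]; letting [n] tend to infinity for fixed [e] leaves each side
    below [1 + e] times the other, and then [e] tends to 0. *)
Lemma rnorm_sqr_fcalc f u : measurable_fun setT f -> fcalc_dom E f u ->
  ((rnorm (fcalc E f u) ^+ 2)%:E = \int[scalar_spm E u]_t (f t ^+ 2)%:E)%E.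
Proof.
move=> mf fu; have [s [sf sw]] := fcalc_spec mf fu.
set w := fcalc E f u in sw *; set W := rnorm w ^+ 2.
have sW : rnorm (spectral_sum E (s n) u) ^+ 2 @[n --> \oo] --> W.
  exact: cvg_rnorm_sqr.
have [Ifin I0] := (fine_cvgP _ _).1 sf.
have [J JE] : exists J, (\int[scalar_spm E u]_t (f t ^+ 2)%:E)%E = J%:E.
  exists (fine (\int[scalar_spm E u]_t (f t ^+ 2)%:E)%E).
  by rewrite fineK// ge0_fin_numE ?integral_sqr_ge0.
have le_scaled (a b : R) : 0 <= b ->
    (forall e, 0 < e -> a <= (1 + e) * b) -> a <= b.
  move=> b0 ab; apply/ler_addgt0Pr => e e0.
  (* Dividing by [b + 1] instead of [b] covers the case [b = 0]. *)
  have b1 : 0 < b + 1 by rewrite ltr_wpDl.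
  have /ab/le_trans : 0 < e / (b + 1) by rewrite divr_gt0.
  apply; rewrite mulrDl mul1r lerD2l -mulrA ler_piMr ?(ltW e0)//.
  by rewrite mulrC ler_pdivrMr// mul1r lerDl.
have lim_rhs (b_ : nat -> R) (b e : R) : b_ @ \oo --> b ->
    (1 + e) * b_ n + (1 + e^-1) *
      fine (\int[scalar_spm E u]_t ((s n t - f t) ^+ 2)%:E)%E @[n --> \oo] -->
    (1 + e) * b.
  move=> bb; rewrite -[X in _ --> X]addr0 -[X in _ --> _ + X](mulr0 (1 + e^-1)).
  by apply: cvgD; apply: cvgMr.
rewrite JE; congr EFin; apply/eqP; rewrite eq_le; apply/andP; split.
  apply: le_scaled => [|e e0]; first by rewrite -lee_fin -JE integral_sqr_ge0.
  apply: (ler_cvg_to sW (lim_rhs (fun=> J) J e (cvg_cst _))).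
  apply: filterS Ifin => n In.
  rewrite -lee_fin rnorm_sqr_spectral_sum EFinD 2!EFinM (fineK In) -JE.
  exact: integral_sqr_le_perturb.
apply: le_scaled => [|e e0]; first by rewrite sqr_ge0.
apply: (ler_cvg_to (cvg_cst _) (lim_rhs _ _ e sW)).
apply: filterS Ifin => n In.
rewrite -lee_fin EFinD EFinM [X in (_ + X)%E]EFinM (fineK In) -JE.
rewrite rnorm_sqr_spectral_sum.
by rewrite integral_sqrB_sym; exact: integral_sqr_le_perturb.
Qed.

(** Scaling [u] by [a] multiplies the measure [scalar_spm E u] by |a|^2. *)
Lemma fcalc_domZ f (a : R[i]) u : measurable_fun setT f ->
  fcalc_dom E f u -> fcalc_dom E f (a *: u).
Proof.
move=> mf; rewrite /fcalc_dom/= => fu.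
pose c : {nonneg R} := NngNum (sqr_ge0 (complex.Re `|a|)).
rewrite (eq_measure_integral (mscale c (scalar_spm E u))); last first.
  by move=> B mB _; rewrite /mscale/= /scalar_spm spmZ// rnormZ exprMn EFinM.
rewrite ge0_integral_mscale//; first last.
- by move=> x _; rewrite lee_fin sqr_ge0.
- exact: measurable_sqr_EFin.
by rewrite lte_mul_pinfty.
Qed.

(** By the parallelogram law, the measures of [u + v] and [u - v] add up to twice the sum of the
    measures of [u] and [v]; the measure of [u + v] is one of the two non-negative summands. *)
Lemma fcalc_domD f u v : measurable_fun setT f ->
  fcalc_dom E f u -> fcalc_dom E f v -> fcalc_dom E f (u + v).
Proof.
move=> mf; rewrite /fcalc_dom/= => fu fv.
have f0 x : setT x -> (0 <= (f x ^+ 2)%:E)%E by rewrite lee_fin sqr_ge0.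
have mf2 := measurable_sqr_EFin mf.
pose mD := measure_add (scalar_spm E (u + v)) (scalar_spm E (u - v)).
pose muv := measure_add (scalar_spm E u) (scalar_spm E v).
have : (\int[mD]_t (f t ^+ 2)%:E < +oo)%E.
  rewrite (eq_measure_integral (measure_add muv muv)); last first.
    move=> B mB _; rewrite /= /msum !big_ord_recl !big_ord0 /=.
    rewrite /measure_add /msum !big_ord_recl !big_ord0 /= !adde0.
    rewrite /scalar_spm -!EFinD.
    have EN : E B (- v) = - E B v by rewrite -scaleN1r spmZ// scaleN1r.
    by rewrite !spmD// EN rnorm_parallelogram.
  rewrite !ge0_integral_measure_add//.
  have fuv := lte_add_pinfty fu fv; exact: (lte_add_pinfty fuv fuv).
rewrite ge0_integral_measure_add//; apply: le_lt_trans.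
by rewrite leeDl ?integral_sqr_ge0.
Qed.

End functional_calculus.

(** * Extension by continuity *)

Section extension_by_continuity.
Context {R : realType} {H : lmodType R[i]}.
Context {V W : completeNormedModType R[i]}.
Variables (D : set H) (j : H -> V) (l : H -> W) (M : R).
Hypothesis D_linear : forall (a : R[i]) u v, D u -> D v -> D (a *: u + v).
Hypothesis j_linear : forall (a : R[i]) u v, D u -> D v ->
  j (a *: u + v) = a *: j u + j v.
Hypothesis l_linear : forall (a : R[i]) u v, D u -> D v ->
  l (a *: u + v) = a *: l u + l v.
Hypothesis M_gt0 : 0 < M.
Hypothesis le_l_j : forall u, D u -> rnorm (l u) <= M * rnorm (j u).
Hypothesis j_dense : dense (j @` D).

(* The closure of the graph of [j u |-> l u]. *)
Let graph (x : V) (y : W) := forall e : R, 0 < e ->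
  exists2 u, D u & rnorm (x - j u) < e /\ rnorm (y - l u) < e.

Let j_approx x (e : R) : 0 < e -> exists2 u, D u & rnorm (x - j u) < e.
Proof.
move=> e0; pose O := (fun y : V => rnorm (x - y)) @^-1` [set r | r < e].
have [y [/= xe [u Du uy]]] : O `&` (j @` D) !=set0; last first.
  by exists u => //; rewrite uy.
apply: j_dense; first by exists x; rewrite /O/= subrr rnorm0.
apply: open_comp; last exact: open_lt.
move=> y _; apply: cvg_rnorm; apply: cvgB; [exact: cvg_cst|exact: cvg_id].
Qed.

(** For [j (u n)] tending to [x], the bound [le_l_j] makes [l (u n)] a Cauchy sequence; its limit is
    the value sought. *)
Let graph_total x : exists y, graph x y.
Proof.
have inv_gt0 n : 0 < n.+1%:R^-1 :> R by rewrite invr_gt0.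
have /(_ _)/cid2-/all_sig[u uP] n := j_approx x (inv_gt0 n).
have [Du xu] : (forall n, D (u n)) /\
    (forall n, rnorm (x - j (u n)) < n.+1%:R^-1).
  by split=> n; have [] := uP n.
have [|y uy] := @rnorm_cauchy_cvg _ _ (fun n => l (u n)).
  move=> e e0.
  (* Two such errors, multiplied by the operator bound [M], add up to [e]. *)
  have eM : 0 < e / (2 * M) by rewrite divr_gt0 ?mulr_gt0.
  have [N _ Ne] := near_infty_natSinv_lt (PosNum eM).
  exists N => n Nn.
  have -> : l (u N) - l (u n) = l ((-1) *: u n + u N).
    by rewrite l_linear// scaleN1r addrC.
  apply: le_lt_trans (le_l_j (D_linear _ (Du _) (Du _))) _.
  rewrite j_linear// scaleN1r addrC.
  have -> : j (u N) - j (u n) = (x - j (u n)) - (x - j (u N)).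
    by rewrite opprB [RHS]addrC addrA subrK.
  have := ler_rnormD (x - j (u n)) (- (x - j (u N))).
  rewrite -(sub0r (x - j (u N))) (rnormB 0) subr0 sub0r => ltj.
  have ltn := lt_trans (xu n) (Ne _ Nn).
  have ltN := lt_trans (xu N) (Ne _ (leqnn N)).
  rewrite mulrC -ltr_pdivlMr//; apply: le_lt_trans ltj _.
  apply: lt_le_trans (ltrD ltn ltN) _ => /=.
  by rewrite le_eqVlt; apply/orP; left; apply/eqP; field; exact: lt0r_neq0.
exists y => e e0.
have /(rnorm_cvgP _ _).1/(_ _ e0)[N1 _ ltl] := uy.
have [N2 _ ltj] := near_infty_natSinv_lt (PosNum e0).
exists (u (maxn N1 N2)); [exact: Du|split].
  by apply: lt_trans (xu _) _; apply: ltj => /=; rewrite leq_maxr.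
by apply: ltl => /=; rewrite leq_maxl.
Qed.

Let graph_bound x y : graph x y -> rnorm y <= M * rnorm x.
Proof.
move=> xy; apply/ler_addgt0Pr => e e0.
(* With tolerance [e / (M + 1)] in both spaces, the error in [W] plus [M] times the error in [V]
   equals [e]. *)
have M1 : 0 < M + 1 by rewrite addr_gt0.
have [u Du [xu yu]] := xy _ (divr_gt0 e0 M1).
move: xu yu; rewrite rnormB => xu yu.
have := ler_rnormD (y - l u) (l u); have := ler_rnormD (j u - x) x.
rewrite !subrK => jx yl.
have : rnorm y <= e / (M + 1) + M * (e / (M + 1) + rnorm x).
  apply: le_trans yl _; apply: lerD; first exact: ltW.
  apply: le_trans (le_l_j Du) _; rewrite ler_pM2l//.
  by apply: le_trans jx _; rewrite lerD2r ltW.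
move=> /le_trans; apply; rewrite le_eqVlt; apply/orP; left; apply/eqP.
by field; exact: lt0r_neq0.
Qed.

Let graph_linear (a : R[i]) x y x' y' : graph x y -> graph x' y' ->
  graph (a *: x + x') (a *: y + y').
Proof.
move=> xy xy' e e0.
have a0 : 0 <= complex.Re `|a|.
  by rewrite -lecR RRe_real ?ger0_real ?normr_ge0.
have a1 : 0 < complex.Re `|a| + 1 by rewrite ltr_wpDl.
have [u Du [xu yu]] := xy _ (divr_gt0 e0 a1).
have [u' Du' [xu' yu']] := xy' _ (divr_gt0 e0 a1).
have comb (U : normedModType R[i]) (z z' w w' : U) :
    rnorm (z - w) < e / (complex.Re `|a| + 1) ->
    rnorm (z' - w') < e / (complex.Re `|a| + 1) ->
    rnorm (a *: z + z' - (a *: w + w')) < e.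
  move=> zw zw'; rewrite opprD addrACA -scalerBr.
  apply: le_lt_trans (ler_rnormD _ _) _; rewrite rnormZ.
  apply: le_lt_trans (lerD (ler_wpM2l a0 (ltW zw)) (lexx _)) _.
  rewrite -ltrBrDl; apply: lt_le_trans zw' _.
  rewrite le_eqVlt; apply/orP; left; apply/eqP.
  by field; exact: lt0r_neq0.
exists (a *: u + u'); first exact: D_linear.
by rewrite j_linear// l_linear//; split; exact: comb.
Qed.

(** By linearity the difference [y' - y] is related to 0, and [graph_bound] forces it to vanish. *)
Let graph_fun x y y' : graph x y -> graph x y' -> y = y'.
Proof.
move=> xy xy'; have := graph_bound (graph_linear (-1) xy xy').
rewrite !scaleN1r addNr rnorm0 mulr0 => y0.
apply/eqP; rewrite eq_sym -subr_eq0 addrC -rnorm_eq0 eq_le y0.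
exact: rnorm_ge0.
Qed.

(** The closed graph is total and single-valued, hence defines a map; linearity and the bound by [M]
    are inherited from the graph, and the bound gives continuity. *)
Lemma extension_by_continuity : exists iota : V -> W,
  [/\ linear iota, continuous iota & forall u, D u -> iota (j u) = l u].
Proof.
have /all_sig[iota iotaP] x := cid (graph_total x).
have iota_lin : linear iota.
  by move=> a x y; apply: graph_fun (iotaP _) (graph_linear a (iotaP x) (iotaP y)).
exists iota; split=> // [x|u Du].
  apply/rnorm_cvgP => e e0; have := nbhs_rnorm_ball x (divr_gt0 e0 M_gt0).
  apply: filterS => y; rewrite ltr_pdivlMr// mulrC; apply: le_lt_trans.
  have -> : iota x - iota y = iota ((-1) *: y + x).
    by rewrite iota_lin scaleN1r addrC.
  by rewrite (addrC x) -(scaleN1r y); exact: graph_bound.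
apply: graph_fun (iotaP _) _ => e e0; exists u => //.
by rewrite !subrr !rnorm0.
Qed.

End extension_by_continuity.

(** * Weights and the spaces H^phi *)

Section weights.
Context {R : realType}.
Implicit Types phi psi : R -> R.

Lemma measurable_invr_gt0 : measurable_fun (`]0, +oo[ : set R) (@GRing.inv R).
Proof.
apply: open_continuous_measurable_fun; first exact: interval_open.
move=> x; rewrite inE/= in_itv/= andbT => x0.
by apply: inv_continuous; exact: lt0r_neq0.
Qed.

Lemma measurable_weight_ratio phi0 phi1 : weight phi0 -> weight phi1 ->
  measurable_fun (`[1, +oo[ : set R) (fun t => phi1 t / phi0 t).
Proof.
move=> [mphi0 phi0_gt0] [mphi1 _]; apply: measurable_funM => //.
apply: (measurable_comp _ _ measurable_invr_gt0 mphi0) => // _ [t /= + <-].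
by rewrite !in_itv/= !andbT => t1; exact: phi0_gt0.
Qed.

Lemma weight_weight_comp psi phi0 phi1 : class_B psi ->
  weight phi0 -> weight phi1 -> weight (weight_comp psi phi0 phi1).
Proof.
move=> [mpsi psi_gt0 _ _] w0 w1; have [mphi0 phi0_gt0] := w0.
have [_ phi1_gt0] := w1; have ratio_gt0 t : 1 <= t -> 0 < phi1 t / phi0 t.
  by move=> t1; rewrite divr_gt0 ?phi0_gt0 ?phi1_gt0.
split=> [|t t1]; last by rewrite mulr_gt0 ?phi0_gt0 ?psi_gt0 ?ratio_gt0.
apply: measurable_funM => //.
apply: (measurable_comp _ _ mpsi (measurable_weight_ratio w0 w1)) => // _ [t /= + <-].
by rewrite !in_itv/= !andbT => t1; exact: ratio_gt0.
Qed.

Lemma measurable_patch_weight phi :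
  weight phi -> measurable_fun setT (phi \_ `[1, +oo[).
Proof. by move=> [mphi _]; apply: (measurable_restrictT _ _).1. Qed.

End weights.

Section phi_spaces.
Context {R : realType} {H : hilbertSpace R} {E : spectralMeasure H}.
Implicit Types (phi : R -> R) (u v : H).

Lemma op_phi_dom_linear phi (a : R[i]) u v : weight phi ->
  op_phi_dom E phi u -> op_phi_dom E phi v -> op_phi_dom E phi (a *: u + v).
Proof.
move=> /measurable_patch_weight mphi phiu phiv.
by apply: fcalc_domD => //; exact: fcalc_domZ.
Qed.

Lemma rnorm_sqr_phi_incl phi (X : phiSpace E phi) u :
  weight phi -> op_phi_dom E phi u ->
  ((rnorm (phi_incl X u) ^+ 2)%:E =
   \int[scalar_spm E u]_t ((phi \_ `[1, +oo[) t ^+ 2)%:E)%E.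
Proof.
move=> /measurable_patch_weight mphi phiu.
by rewrite rnorm_phi_incl// rnorm_sqr_fcalc.
Qed.

Section domination.
Variables (phi phi0 phi1 : R -> R) (a b : R).
Hypotheses (phi_weight : weight phi) (phi0_weight : weight phi0).
Hypotheses (phi1_weight : weight phi1) (a_ge0 : 0 <= a) (b_ge0 : 0 <= b).
Hypothesis le_phi : forall t, 1 <= t ->
  phi t ^+ 2 <= a * phi0 t ^+ 2 + b * phi1 t ^+ 2.

Let le_integral u : (\int[scalar_spm E u]_t ((phi \_ `[1, +oo[) t ^+ 2)%:E <=
  a%:E * \int[scalar_spm E u]_t ((phi0 \_ `[1, +oo[) t ^+ 2)%:E +
  b%:E * \int[scalar_spm E u]_t ((phi1 \_ `[1, +oo[) t ^+ 2)%:E)%E.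
Proof.
apply: integral_sqr_le2 => //; try exact: measurable_patch_weight.
(* Outside [[1, +oo[] all three patched weights vanish. *)
move=> t; rewrite !patchE; case: ifPn => [|_].
  by rewrite inE/= in_itv/= andbT; exact: le_phi.
by rewrite expr0n/= !mulr0 addr0.
Qed.

Lemma op_phi_dom_dominated u :
  op_phi_dom E phi0 u -> op_phi_dom E phi1 u -> op_phi_dom E phi u.
Proof.
move=> phi0u phi1u; apply: le_lt_trans (le_integral u) _.
by apply: lte_add_pinfty; apply: lte_mul_pinfty.
Qed.

Lemma rnorm_sqr_phi_incl_dominated
    (X : phiSpace E phi) (X0 : phiSpace E phi0) (X1 : phiSpace E phi1) u :
  op_phi_dom E phi0 u -> op_phi_dom E phi1 u ->
  rnorm (phi_incl X u) ^+ 2 <=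
  a * rnorm (phi_incl X0 u) ^+ 2 + b * rnorm (phi_incl X1 u) ^+ 2.
Proof.
move=> phi0u phi1u; have phiu := op_phi_dom_dominated phi0u phi1u.
rewrite -lee_fin EFinD [X in (_ <= X + _)%E]EFinM [X in (_ <= _ + X)%E]EFinM.
by rewrite !rnorm_sqr_phi_incl.
Qed.

End domination.

Section embedding.
Variables (phi0 phi1 : R -> R) (M : R).
Hypotheses (phi0_weight : weight phi0) (phi1_weight : weight phi1).
Hypotheses (M_gt0 : 0 < M) (le_phi : forall t, 1 <= t -> phi0 t <= M * phi1 t).

(** Domination by a single weight is cast in the two-weight form, with [phi1] in both places and
    second coefficient 0, so that the results on domination apply. *)
Let le_sqr t : 1 <= t ->
  phi0 t ^+ 2 <= M ^+ 2 * phi1 t ^+ 2 + 0 * phi1 t ^+ 2.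
Proof.
move=> t1; rewrite mul0r addr0 -exprMn ler_sqr ?le_phi// nnegrE.
  by rewrite ltW// phi0_weight.2.
by rewrite mulr_ge0// ltW// phi1_weight.2.
Qed.

Lemma op_phi_dom_subset : op_phi_dom E phi1 `<=` op_phi_dom E phi0.
Proof.
move=> u phi1u; apply: (op_phi_dom_dominated _ _ _ _ _ le_sqr) => //.
by rewrite exprn_ge0// ltW.
Qed.

(** Extension by continuity, applied to [phi_incl X0] on the smaller domain, shows that a map as
    required exists, so the [xget] in [phi_embedding] does not fall back on the zero map. *)
Lemma phi_embedding_spec (X0 : phiSpace E phi0) (X1 : phiSpace E phi1) :
  [/\ linear (phi_embedding X1 X0), continuous (phi_embedding X1 X0) &
      forall u, op_phi_dom E phi1 u ->
        phi_embedding X1 X0 (phi_incl X1 u) = phi_incl X0 u].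
Proof.
apply: (@xgetPex _ (fun=> 0) [set iota : X1 -> X0 |
  [/\ linear iota, continuous iota & forall u, op_phi_dom E phi1 u ->
      iota (phi_incl X1 u) = phi_incl X0 u]]).
apply: (@extension_by_continuity _ _ _ _ (op_phi_dom E phi1) _ _ M) => //.
- by move=> a u v; exact: op_phi_dom_linear.
- by move=> a u v; exact: phi_incl_linear.
- by move=> a u v phi1u phi1v; apply: phi_incl_linear; exact: op_phi_dom_subset.
- move=> u phi1u; rewrite -ler_sqr ?nnegrE ?rnorm_ge0 ?mulr_ge0 ?rnorm_ge0
    ?(ltW M_gt0)// exprMn -[leRHS]addr0.
  rewrite -[X in _ <= _ + X](mul0r (rnorm (phi_incl X1 u) ^+ 2)).
  apply: (rnorm_sqr_phi_incl_dominated _ _ _ _ _ le_sqr) => //.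
  by rewrite exprn_ge0// ltW.
- exact: phi_incl_dense.
Qed.

End embedding.

End phi_spaces.

(** * The interpolation parameter *)

Section interpolation_parameters.
Context {R : realType}.
Implicit Types phi psi : R -> R.

Lemma bounded_on_gt0 (A : set R) (f : R -> R) : [bounded f t | t in A] ->
  exists2 M : R, 0 < M & forall t, A t -> f t <= M.
Proof.
move=> /ex_strict_bound_gt0[M M0 fM]; exists M => // t At.
by apply/ltW; apply: le_lt_trans (ler_norm _) _; exact: fM.
Qed.

Lemma concave_on_le (A : set R) psi (s x y : R) : concave_on A psi ->
  A x -> A y -> 0 <= s -> s <= 1 ->
  s * psi x + (1 - s) * psi y <= psi (s * x + (1 - s) * y).
Proof.
move=> psi_concave Ax Ay s0 s1.
have := psi_concave (Itv01 s0 s1) x y (mem_set Ax) (mem_set Ay).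
by rewrite !convRE/= /unstable.onem !mulrN -opprD lerN2.
Qed.

(** * Positive concave functions on a half-line *)

Section concave_positive.
Variables (r : R) (psi : R -> R).
Hypotheses (r_gt0 : 0 < r) (psi_gt0 : forall t, r < t -> 0 < psi t).
Hypothesis psi_concave : concave_on `]r, +oo[ psi.

(** Concavity with denominators cleared: [tau] is the convex combination of [t] and [p] in which [t]
    has weight [(tau - p) / (t - p)]. *)
Let chord p t tau : r < p -> p < tau -> tau <= t ->
  (tau - p) * psi t + (t - tau) * psi p <= (t - p) * psi tau.
Proof.
move=> rp ptau taut.
have rt := lt_le_trans (lt_trans rp ptau) taut.
have tp : 0 < t - p by rewrite subr_gt0 (lt_le_trans ptau).
have s0 : 0 <= (tau - p) / (t - p) by rewrite divr_ge0 ?(ltW tp)// subr_ge0 ltW.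
have s1 : (tau - p) / (t - p) <= 1 by rewrite ler_pdivrMr// mul1r lerD2r.
have in_dom x : r < x -> [set` `]r, +oo[] x by rewrite /= in_itv/= andbT.
have := concave_on_le psi_concave (in_dom t rt) (in_dom p rp) s0 s1.
have tpN0 := lt0r_neq0 tp.
have -> : (tau - p) / (t - p) * t + (1 - (tau - p) / (t - p)) * p = tau by field.
rewrite -(ler_pM2l tp); apply: le_trans.
by rewrite le_eqVlt; apply/orP; left; apply/eqP; field.
Qed.

(** Beyond [tau] a concave function stays below the line through its values at [p] and [tau]. If
    that line descended, it would become negative, against positivity. *)
Lemma concave_positive_nondecreasing p tau : r < p -> p < tau -> psi p <= psi tau.
Proof.
move=> rp ptau; rewrite leNgt; apply/negP => lt_psi.
have p0 : 0 < p by apply: lt_trans rp.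
have d0 : 0 < psi p - psi tau by rewrite subr_gt0.
have psip := psi_gt0 rp; have psitau := psi_gt0 (lt_trans rp ptau).
(* The descending line reaches 0 at distance [(tau - p) * psi tau / (psi p - psi tau)] beyond [tau];
   [h] exceeds this distance. *)
pose h := psi p * tau / (psi p - psi tau).
have h0 : 0 < h by rewrite divr_gt0// mulr_gt0// (lt_trans p0).
have hE : h * (psi p - psi tau) = psi p * tau by rewrite divfK// lt0r_neq0.
have taut : tau < tau + h by rewrite ltrDl.
have := chord rp ptau (ltW taut).
have psit := psi_gt0 (lt_trans rp (lt_trans ptau taut)).
have : 0 <= (tau - p) * psi (tau + h) by rewrite mulr_ge0 ?ltW// subr_gt0.
have : 0 < p * psi tau by rewrite mulr_gt0.
have : (tau - p) * psi tau <= (tau - p) * psi p.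
  by rewrite ler_pM2l ?subr_gt0// ltW.
nra.
Qed.

Lemma concave_positive_ratio t tau : 2 * r < tau -> r < t ->
  psi t <= 2 * Num.max 1 (t / tau) * psi tau.
Proof.
move=> rtau rt; have tau0 : 0 < tau by apply: lt_trans rtau; rewrite mulr_gt0.
have rtau1 : r < tau by apply: lt_trans rtau; rewrite mulr_natl mulr2n ltrDl.
have psitau := psi_gt0 rtau1.
have [ttau|taut] := ltP t tau.
  apply: le_trans (concave_positive_nondecreasing rt ttau) _.
  rewrite ler_peMl ?(ltW psitau)//.
  have : 1 <= Num.max 1 (t / tau) by rewrite le_max lexx.
  lra.
(* The assumption [2 * r < tau] keeps the left end [tau / 2] of the chord in the domain; the
   remaining length [tau / 2] is the source of the factor 2. *)
have rp : r < tau / 2 by rewrite ltr_pdivlMr// mulrC.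
have ptau : tau / 2 < tau by rewrite ltr_pdivrMr// ltr_pMr// ltr1n.
have := chord rp ptau taut; have psip := psi_gt0 rp.
have : 0 <= (t - tau) * psi (tau / 2) by rewrite mulr_ge0 ?subr_ge0// ltW.
have : (t / tau) <= Num.max 1 (t / tau) by rewrite le_max lexx orbT.
set m := Num.max _ _; rewrite ler_pdivrMr// => tm c0 c1.
rewrite -(ler_pM2l (_ : 0 < tau / 2)) ?divr_gt0//.
have : (tau - tau / 2) * psi t <= (t - tau / 2) * psi tau by lra.
have : (t - tau / 2) * psi tau <= m * tau * psi tau.
  by rewrite ler_pM2r//; lra.
lra.
Qed.

End concave_positive.

(** Beyond a threshold [r'] the function is comparable with a concave one. Below it, the bounds on
    [psi] and on its inverse from [class_B] take over, and the mixed case passes through the value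
    at [r']. *)
Lemma pseudoconcave_ratio_bound psi (k : R) : 0 < k ->
  class_B psi -> pseudoconcave_near_infty psi ->
  exists2 c : R, 0 < c & ratio_bound psi k c.
Proof.
move=> k0 [_ psi_gt0 psi_bounded psiV_bounded].
move=> [r [psi1 [r0 psi1_gt0 psi1_concave]]].
move=> /bounded_on_gt0[C1 C10 le1] /bounded_on_gt0[C2 C20 le2].
(* Beyond [2 * r] the concave estimate applies, and [k < r'] makes [psi] bounded on the interval
   from [k] to [r']. *)
pose r' := 2 * r + k + 1.
have kr' : k < r' by rewrite /r'; lra.
have rr' : 2 * r < r' by rewrite /r'; lra.
have r1r' : r < r' by rewrite /r'; lra.
have r'0 : 0 < r' by exact: lt_trans kr'.
have [B B0 leB] := bounded_on_gt0 (psi_bounded _ _ k0 kr').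
have [B' B'0 leB'] := bounded_on_gt0 (psiV_bounded _ k0).
pose C := 2 * (C1 * C2).
have C0 : 0 < C by rewrite !mulr_gt0.
have far t tau : r' <= t -> r' <= tau ->
    psi t <= C * Num.max 1 (t / tau) * psi tau.
  move=> r't r'tau; have rt := lt_le_trans r1r' r't.
  have rtau := lt_le_trans r1r' r'tau; have rtau2 := lt_le_trans rr' r'tau.
  have psit : psi t <= C1 * psi1 t.
    by rewrite -ler_pdivrMr ?psi1_gt0//; apply: le1; rewrite /= in_itv/= andbT.
  have psitau : psi1 tau <= C2 * psi tau.
    rewrite -ler_pdivrMr ?psi_gt0 ?(lt_trans r0)//.
    by apply: le2; rewrite /= in_itv/= andbT.
  apply: le_trans psit _.
  have := concave_positive_ratio r0 psi1_gt0 psi1_concave rtau2 rt.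
  have : 1 <= Num.max 1 (t / tau) by rewrite le_max lexx.
  set m := Num.max _ _ => m1 psi1t.
  have m0 : 0 < m by apply: lt_le_trans m1.
  apply: le_trans (ler_wpM2l (ltW C10) psi1t) _.
  have -> : C1 * (2 * m * psi1 tau) = 2 * C1 * m * psi1 tau by ring.
  have -> : C * m * psi tau = 2 * C1 * m * (C2 * psi tau) by rewrite /C; ring.
  by rewrite ler_pM2l// !mulr_gt0.
(* The summands serve, in this order, the cases where both points are at least [r'], where [t < r'],
   and where [tau < r' <= t]. *)
exists (C + B * B' + C * B * B'); first by rewrite !addr_gt0// !mulr_gt0.
move=> t tau kt ktau.
have t0 := lt_le_trans k0 kt; have tau0 := lt_le_trans k0 ktau.
have psitau := psi_gt0 _ tau0; have psit := psi_gt0 _ t0.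
have psiV : (psi tau)^-1 <= B' by apply: leB'; rewrite /= in_itv/= andbT.
have psiV0 : 0 < (psi tau)^-1 by rewrite invr_gt0.
have m1 : 1 <= Num.max 1 (t / tau) by rewrite le_max lexx.
have mt : t / tau <= Num.max 1 (t / tau) by rewrite le_max lexx orbT.
set m := Num.max _ _ in m1 mt *.
have m0 : 0 < m by apply: lt_le_trans m1.
have BB'0 := mulr_gt0 B0 B'0.
have Cm0 := mulr_gt0 C0 m0; have BB'm0 := mulr_gt0 BB'0 m0.
have CBB'm0 := mulr_gt0 (mulr_gt0 C0 BB'0) m0.
have [r't|tr'] := leP r' t; last first.
  have : psi t / psi tau <= B * B'.
    by apply: ler_pM => //; try exact: ltW; apply: leB; rewrite /= in_itv/= kt ltW.
  have : B * B' <= B * B' * m by rewrite ler_pMr.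
  lra.
have [r'tau|taur'] := leP r' tau.
  have : psi t / psi tau <= C * m by rewrite ler_pdivrMr//; exact: far.
  lra.
(* The mixed case: [psi t] is compared with [psi r'], which is at most [B], while [tau < r'] makes
   [t / r'] smaller than [t / tau]. *)
have := far _ _ r't (lexx r').
have -> : Num.max 1 (t / r') = t / r'.
  by apply/max_idPr; rewrite ler_pdivlMr// mul1r.
have : t / r' <= m.
  by apply: le_trans mt; rewrite ler_pM2l// lef_pV2 ?posrE// ltW.
have : psi r' <= B by apply: leB; rewrite /= in_itv/= lexx ltW.
have psir' := psi_gt0 _ r'0; move=> psir'B tr'm psitr'.
have : psi t <= C * m * B.
  apply: le_trans psitr' _; apply: ler_pM => //; last exact: ler_wpM2l (ltW C0) _ _ tr'm.
  - by rewrite mulr_ge0 ?divr_ge0 ?ltW.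
  - exact: ltW.
move=> psitB; have : psi t / psi tau <= C * m * B * B'.
  by apply: ler_pM => //; exact: ltW.
lra.
Qed.

(** * The infimum [kappa] and the pointwise estimate of the composed weight *)

Section kappa.
Variables (phi0 phi1 : R -> R).
Hypotheses (phi0_weight : weight phi0) (phi1_weight : weight phi1).
Hypothesis phi01_bounded : [bounded phi0 t / phi1 t | t in `[1, +oo[].

Lemma weight_ratio_bound :
  exists2 M : R, 0 < M & forall t, 1 <= t -> phi0 t <= M * phi1 t.
Proof.
have [M M0 leM] := bounded_on_gt0 phi01_bounded; exists M => // t t1.
by rewrite -ler_pdivrMr ?phi1_weight.2//; apply: leM; rewrite /= in_itv/= andbT.
Qed.

(** If [phi0 <= M * phi1] on [[1, +oo[], then [M^-1] is a lower bound of the ratios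
    [phi1 t / phi0 t]. *)
Lemma kappa_gt0 : 0 < kappa phi0 phi1.
Proof.
have [M M0 leM] := weight_ratio_bound.
have MV0 : 0 < M^-1 by rewrite invr_gt0.
apply: lt_le_trans MV0 _; apply: lb_le_inf.
  by exists (phi1 1 / phi0 1), 1 => //=; rewrite in_itv/= lexx.
move=> _ [t /= + <-]; rewrite in_itv/= andbT => t1.
by rewrite ler_pdivlMr ?phi0_weight.2// mulrC ler_pdivrMr// mulrC leM.
Qed.

Lemma kappa_le t : 1 <= t -> kappa phi0 phi1 <= phi1 t / phi0 t.
Proof.
move=> t1; apply: ge_inf; last by exists t => //=; rewrite in_itv/= andbT.
exists 0 => _ [x /= + <-]; rewrite in_itv/= andbT => x1.
by rewrite divr_ge0// ltW ?phi0_weight.2 ?phi1_weight.2.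
Qed.

Lemma weight_comp_sqr_le psi (c tau t : R) : class_B psi -> 0 < c ->
  ratio_bound psi (kappa phi0 phi1) c -> kappa phi0 phi1 <= tau -> 1 <= t ->
  weight_comp psi phi0 phi1 t ^+ 2 <=
  (c * psi tau) ^+ 2 * phi0 t ^+ 2 +
  (c * psi tau) ^+ 2 * tau ^- 2 * phi1 t ^+ 2.
Proof.
move=> [_ psi_gt0 _ _] c0 psi_ratio ktau t1.
have tau0 := lt_le_trans kappa_gt0 ktau.
have p0 := phi0_weight.2 _ t1; have p1 := phi1_weight.2 _ t1.
have x0 := divr_gt0 p1 p0; have psitau := psi_gt0 _ tau0.
have := psi_ratio _ _ (kappa_le t1) ktau; rewrite ler_pdivrMr//.
rewrite /weight_comp; set x := phi1 t / phi0 t in x0 *.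
(* In terms of the ratio [x], both sides carry the common factor [phi0 t ^+ 2]. *)
have -> : phi1 t = x * phi0 t by rewrite divfK// lt0r_neq0.
set m := Num.max _ _ => psix.
have m_sqr : m ^+ 2 <= 1 + (x / tau) ^+ 2.
  rewrite /m; case: (leP 1 (x / tau)) => _; rewrite ?expr1n ?lerDl ?lerDr ?sqr_ge0//.
have m0 : 0 < m by rewrite lt_max ltr01.
have psix_sqr : psi x ^+ 2 <= (c * psi tau) ^+ 2 * m ^+ 2.
  have psix0 := ltW (psi_gt0 _ x0); have cm0 := mulr_gt0 (mulr_gt0 c0 psitau) m0.
  by rewrite -exprMn ler_sqr ?nnegrE//; [rewrite mulrAC|exact: ltW].
have -> : (c * psi tau) ^+ 2 * phi0 t ^+ 2 +
    (c * psi tau) ^+ 2 * tau ^- 2 * (x * phi0 t) ^+ 2 =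
    phi0 t ^+ 2 * ((c * psi tau) ^+ 2 * (1 + (x / tau) ^+ 2)).
  by field; exact: lt0r_neq0.
rewrite exprMn ler_wpM2l ?sqr_ge0//; apply: le_trans psix_sqr _.
by rewrite ler_wpM2l ?sqr_ge0.
Qed.

End kappa.

End interpolation_parameters.

(** * Passage to the completions and the norm inequality *)

Lemma dense_le {R : realType} {V : topologicalType} (S : set V) (f g : V -> R) :
  dense S -> continuous f -> continuous g ->
  (forall x, S x -> f x <= g x) -> forall x, f x <= g x.
Proof.
move=> S_dense cf cg fg x; rewrite leNgt; apply/negP => gfx.
(* The set where the inequality fails is open; if it contained [x], it would meet the dense set
   [S]. *)
pose O := (fun y => f y - g y) @^-1` [set r | 0 < r].
have [y [/= Oy /fg]] : O `&` S !=set0.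
  apply: S_dense; first by exists x; rewrite /O/= subr_gt0.
  apply: open_comp; last exact: open_gt.
  by move=> y _; apply: cvgB; [exact: cf|exact: cg].
by rewrite leNgt -subr_gt0 Oy.
Qed.

(** The constants [M0] and [M] secure the existence and continuity of the two embeddings. On the
    dense image of Dom phi1(A) the embeddings act as the identity, so domination of weights applies
    there and continuity does the rest. *)
Lemma rnorm_sqr_phi_embedding_le {R : realType} {H : hilbertSpace R}
    {E : spectralMeasure H} (phi0 phi1 phi : R -> R) (M0 M a b : R)
    (X0 : phiSpace E phi0) (X1 : phiSpace E phi1) (X : phiSpace E phi) :
  weight phi0 -> weight phi1 -> weight phi ->
  0 < M0 -> (forall t, 1 <= t -> phi0 t <= M0 * phi1 t) ->
  0 < M -> (forall t, 1 <= t -> phi t <= M * phi1 t) ->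
  0 <= a -> 0 <= b ->
  (forall t, 1 <= t -> phi t ^+ 2 <= a * phi0 t ^+ 2 + b * phi1 t ^+ 2) ->
  forall u : X1, rnorm (phi_embedding X1 X u) ^+ 2 <=
    a * rnorm (phi_embedding X1 X0 u) ^+ 2 + b * rnorm u ^+ 2.
Proof.
move=> w0 w1 w M0_gt0 le0 M_gt0 leM a0 b0 le_phi.
have [_ cont0 emb0] := phi_embedding_spec w0 w1 M0_gt0 le0 X0 X1.
have [_ cont emb] := phi_embedding_spec w w1 M_gt0 leM X X1.
apply: (@dense_le _ X1 _ (fun u => rnorm (phi_embedding X1 X u) ^+ 2)
  (fun u => a * rnorm (phi_embedding X1 X0 u) ^+ 2 + b * rnorm u ^+ 2)
  (@phi_incl_dense _ _ _ _ X1)) => [|x|_ [u phi1u <-]].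
- by move=> x; apply: cvg_rnorm_sqr; exact: cont.
- apply: cvgD; apply: cvgMr; apply: cvg_rnorm_sqr; first exact: cont0.
  exact: cvg_id.
rewrite emb// emb0//; apply: rnorm_sqr_phi_incl_dominated => //.
exact: (op_phi_dom_subset w0 w1 M0_gt0 le0).
Qed.

Theorem theorem4p1 (R : realType) (H : hilbertSpace R)
    (H_separable : separable H) (H_infinite : infinite_dimensional H)
    (A : linearOperator H)
    (A_self_adjoint : self_adjoint A) (A_unbounded : unbounded_operator A)
    (A_ge1 : forall u, op_dom A u -> inner H u u <= inner H (A u) u)
    (E : spectralMeasure H) (E_A : spectral_decomposition E A)
    (phi0 phi1 : R -> R) (phi0_weight : weight phi0) (phi1_weight : weight phi1)
    (phi01_bounded : [bounded phi0 t / phi1 t | t in `[1, +oo[])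
    (psi : R -> R) (psi_B : class_B psi)
    (psi_pseudoconcave : pseudoconcave_near_infty psi)
    (X0 : phiSpace E phi0) (X1 : phiSpace E phi1)
    (X : phiSpace E (weight_comp psi phi0 phi1)) :
  let k := kappa phi0 phi1 in
  [/\ 0 < k,
      exists2 c : R, 0 < c & ratio_bound psi k c &
      forall c : R, 0 < c -> ratio_bound psi k c ->
      forall (tau : R) (u : X1), k <= tau ->
        rnorm (phi_embedding X1 X u) <=
        c * psi tau *
        Num.sqrt (rnorm (phi_embedding X1 X0 u) ^+ 2 +
                  tau ^- 2 * rnorm u ^+ 2)].
Proof.
move=> k; have k0 : 0 < k := kappa_gt0 phi0_weight phi1_weight phi01_bounded.
split=> [//||c c0 psi_ratio tau u ktau].
  exact: pseudoconcave_ratio_bound.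
have [M0 M0_gt0 le0] := weight_ratio_bound phi1_weight phi01_bounded.
have w := weight_weight_comp psi_B phi0_weight phi1_weight.
have le_phi t := @weight_comp_sqr_le _ _ _ phi0_weight phi1_weight
  phi01_bounded psi c tau t psi_B c0 psi_ratio ktau.
have tau0 := lt_le_trans k0 ktau.
have psitau : 0 < psi tau by case: psi_B => _ + _ _; apply.
have K0 : 0 < c * psi tau by rewrite mulr_gt0.
have KM0 := mulr_gt0 K0 M0_gt0; have Ktau := divr_gt0 K0 tau0.
have M_gt0 := addr_gt0 KM0 Ktau.
(* This bound yields the embedding of [X1] into [X]. Inserting [phi0 <= M0 * phi1] into the
   pointwise estimate leaves a sum of two squares times [phi1 t ^+ 2], and a sum of squares of
   positive numbers is at most the square of their sum. *)
have leM t : 1 <= t -> weight_comp psi phi0 phi1 t <=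
    (c * psi tau * M0 + c * psi tau / tau) * phi1 t.
  move=> t1; have p1 := phi1_weight.2 _ t1; have p0 := phi0_weight.2 _ t1.
  have Mp1 := mulr_gt0 M_gt0 p1.
  rewrite -ler_sqr ?nnegrE; [|exact/ltW/w.2|exact: ltW].
  apply: le_trans (le_phi _ t1) _.
  have sqr0 : phi0 t ^+ 2 <= (M0 * phi1 t) ^+ 2.
    by rewrite ler_sqr ?nnegrE ?le0//; apply: ltW => //; exact: mulr_gt0.
  apply: le_trans (lerD (ler_wpM2l (sqr_ge0 _) sqr0) (lexx _)) _.
  rewrite -subr_ge0 (_ : _ - _ =
    2 * (c * psi tau * M0) * (c * psi tau / tau) * phi1 t ^+ 2).
    apply: mulr_ge0; last exact: sqr_ge0.
    by apply: mulr_ge0 (ltW Ktau); apply: mulr_ge0 (ltW KM0).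
  by field; exact: lt0r_neq0.
have tauV0 : 0 <= tau ^- 2 by rewrite invr_ge0 sqr_ge0.
have rhs0 : 0 <= rnorm (phi_embedding X1 X0 u) ^+ 2 + tau ^- 2 * rnorm u ^+ 2.
  by apply: addr_ge0; [exact: sqr_ge0|exact: mulr_ge0 tauV0 (sqr_ge0 _)].
(* Both sides are non-negative, so it suffices to compare squares, with coefficients
   [(c * psi tau) ^+ 2] and [(c * psi tau) ^+ 2 * tau ^- 2]. *)
rewrite -ler_sqr ?nnegrE ?rnorm_ge0 ?(mulr_ge0 (ltW K0)) ?sqrtr_ge0//.
rewrite exprMn sqr_sqrtr// mulrDr [X in _ <= _ + X]mulrA.
apply: (rnorm_sqr_phi_embedding_le (M0 := M0)
  (M := c * psi tau * M0 + c * psi tau / tau)) => //.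
  exact: sqr_ge0.
by rewrite mulr_ge0 ?sqr_ge0.
Qed.
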